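(* The asymptotic competitive ratio of every online algorithm, deterministic or randomized, for the online minimum peak appointment scheduling problem (MPAS) is at least $1.2691534$.
   Context: MPAS: items arrive one by one, each with a size $s\in(0,1]$. Upon arrival, the online algorithm must irrevocably assign the item an interval $[x,x+s)$ with $0\le x\le 1-s$, before the next item arrives. The cost of an assignment is the maximum, over points $z\in[0,1)$, of the number of assigned intervals containing $z$ (equivalently, the minimum number of bins $[0,1)$ into which the intervals can be placed so that intervals in the same bin are pairwise disjoint). $\mathrm{OPT}(I)$ is the minimum cost over all assignments of intervals to the items of input $I$. An online algorithm $A$ (possibly randomized) has asymptotic competitive ratio at most $R$ if there is a constant $C$ such that $\mathbb{E}[A(I)]\le R\cdot\mathrm{OPT}(I)+C$ for all inputs $I$; its asymptotic competitive ratio is the infimum of such $R$. *)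

(* Defs.v *)
From HB Require Import structures.
From mathcomp Require Import all_boot all_order all_algebra.
From mathcomp Require Import all_classical all_reals all_analysis.

Set Implicit Arguments.
Unset Strict Implicit.
Unset Printing Implicit Defensive.

Import Order.TTheory GRing.Theory Num.Theory.

Local Open Scope classical_set_scope.
Local Open Scope ring_scope.

Section MPAS.
Context {R : realType}.

Definition is_size (s : R) : bool := 0 < s <= 1.

(* The items of an input, in order of arrival; the empty input is allowed. *)
Definition is_input (I : seq R) : bool := all is_size I.

(* [nth 0 X k] is the left endpoint of the interval given to the k-th item. *)
Definition is_assignment (I X : seq R) : Prop :=
  size X = size I /\
  forall k, (k < size I)%N -> 0 <= nth 0 X k <= 1 - nth 0 I k.

Definition load (I X : seq R) (z : R) : nat :=
  (\sum_(k < size I) (nth 0 X k <= z < nth 0 X k + nth 0 I k)%R)%N.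

(* The set of loads is nonempty and bounded by the number of items, so this
   supremum in [nat] is a maximum; see [peak_attained] and [load_le_peak]. *)
Definition peak (I X : seq R) : nat :=
  supremum 0%N [set load I X z | z in `[0, 1[].

(* For every input this infimum in [nat] is a minimum; see [opt_attained] and
   [opt_le_peak]. *)
Definition opt (I : seq R) : nat :=
  infimum 0%N [set peak I X | X in is_assignment I].

(* [place past s] is the left endpoint given to an arriving item of size [s]
   when the earlier items have sizes [past]. The earlier positions are not an
   argument: they are determined by [past]. *)
Record online_alg := OnlineAlg {
  place : seq R -> R -> R;
  placeP : forall past s, is_input past -> is_size s ->
    0 <= place past s <= 1 - s }.

Definition run (A : online_alg) (I : seq R) : seq R :=
  mkseq (fun k => place A (take k I) (nth 0 I k)) (size I).

Definition cost (A : online_alg) (I : seq R) : nat := peak I (run A I).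

(* A randomized algorithm draws a seed from a probability space and then behaves
   deterministically; each interval position is a random variable. *)
Record randomized_alg d (T : measurableType d) := RandomizedAlg {
  alg_of_seed : T -> online_alg;
  measurable_place : forall past s, is_input past -> is_size s ->
    measurable_fun setT (fun w => place (alg_of_seed w) past s) }.

Definition expected_cost d (T : measurableType d) (P : probability T R)
    (A : randomized_alg T) (I : seq R) : \bar R :=
  ('E_P[fun w => (cost (alg_of_seed A w) I)%:R])%E.

(* [c I] is the (expected) cost incurred on the input [I]. *)
Definition ratio_at_most (c : seq R -> \bar R) (r : R) : Prop :=
  exists C : R, forall I, is_input I -> (c I <= (r * (opt I)%:R + C)%:E)%E.

(* [+oo] when no finite ratio is achieved. *)
Definition asymptotic_ratio (c : seq R -> \bar R) : \bar R :=
  ereal_inf [set r%:E | r in [set r | ratio_at_most c r]].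

Lemma load_le_size I X z : (load I X z <= size I)%N.
Proof.
rewrite -[leqRHS]card_ord -sum1_card; apply: leq_sum => k _.
by case: (_ <= _ < _).
Qed.

Let has_sup_loads I X :
  supremums [set load I X z | z in `[0, 1[] !=set0.
Proof.
apply: nat_supremums_neq0; exists (size I) => _ [z _ <-].
exact: load_le_size.
Qed.

Lemma load_le_peak I X z : 0 <= z < 1 -> (load I X z <= peak I X)%N.
Proof.
move=> z01; rewrite -leEnat; apply: ge_supremum_Nmem => //.
by exists z => //=; rewrite in_itv.
Qed.

Lemma peak_attained I X : exists2 z, 0 <= z < 1 & load I X z = peak I X.
Proof.
pose p n := `[< exists2 z, 0 <= z < 1 & load I X z = n >].
have exp : exists n, p n.
  exists (load I X 0); apply/asboolP; exists 0 => //.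
  by rewrite lexx ltr01.
have ubp n : p n -> (n <= size I)%N.
  by move=> /asboolP[z _ <-]; exact: load_le_size.
case: (ex_maxnP exp ubp) => m /asboolP[z z01 zm] maxm; exists z => //.
apply/eqP; rewrite eqn_leq load_le_peak //= zm /peak /supremum.
case: ifPn => // _; case: xgetP => [n _ [_ lubn]|//].
rewrite -leEnat; apply: lubn => _ [y y01 <-]; apply: maxm.
by apply/asboolP; exists y => //; move: y01; rewrite /= in_itv.
Qed.

Lemma opt_le_peak I X : is_assignment I X -> (opt I <= peak I X)%N.
Proof.
move=> IX; rewrite -leEnat; apply: le_infimum_Nmem; last by exists X.
pose p n := `[< exists2 Y, is_assignment I Y & peak I Y = n >].
have exp : exists n, p n by exists (peak I X); apply/asboolP; exists X.
case: (ex_minnP exp) => m /asboolP[Y IY Ym] minm; exists m; split.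
  by move=> _ [Z IZ <-]; apply: minm; apply/asboolP; exists Z.
by move=> n; apply; exists Y.
Qed.

Lemma opt_attained I :
  is_input I -> exists2 X, is_assignment I X & peak I X = opt I.
Proof.
move=> inI.
have I0 : is_assignment I (nseq (size I) 0).
  split=> [|k kI]; first by rewrite size_nseq.
  rewrite nth_nseq kI lexx subr_ge0.
  by have /andP[] := all_nthP 0 inI k kI.
pose p n := `[< exists2 Y, is_assignment I Y & peak I Y = n >].
have exp : exists n, p n by eexists; apply/asboolP; exists (nseq (size I) 0).
case: (ex_minnP exp) => m /asboolP[Y IY Ym] minm; exists Y => //.
rewrite Ym /opt /infimum; case: ifPn => [/eqP A0|_].
  by have : [set peak I X | X in is_assignment I] (peak I Y); [exists Y|rewrite A0].
case: xgetP => [n _ [lbn glbn]|/(_ m) []].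
  apply/eqP; rewrite eqn_leq -!leEnat -{2}Ym; apply/andP; split.
    by apply: glbn => _ [Z IZ <-]; apply: minm; apply/asboolP; exists Z.
  by apply: lbn; exists Y.
split; last by move=> n; apply; exists Y.
by move=> _ [Z IZ <-]; apply: minm; apply/asboolP; exists Z.
Qed.

Lemma run_is_assignment (A : online_alg) I :
  is_input I -> is_assignment I (run A I).
Proof.
move=> inI; split=> [|k kI]; first by rewrite size_mkseq.
rewrite nth_mkseq //; apply: placeP; last exact: (all_nthP 0 inI).
by apply/allP => s /mem_take; apply: (allP inI).
Qed.

End MPAS.

Arguments online_alg : clear implicits.
Arguments randomized_alg R {d} T.

(* Main.v *)
(** The adversary first sends a multiple [N] of [(2 h)!] items of size [1 / m],
where [m = 2 h], and then either stops or, for some [0 < k < h], continues with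
[N / k] items of size [1 - k / m]. The optimum is [N / m], respectively [N / k]:
each bin holds one large item and [k] small ones. All large items of branch [k]
contain the points [k / m] and [(m - 1 - k) / m], and these points together form
a grid of step [1 / m], which every small item meets. An algorithm of ratio [r]
therefore puts, up to an additive constant, at most [r N / m] small items over
any grid point and at most [(r - 1) N / k] over either point of branch [k].
Counting the small items by grid points, with the first bound for [k <= a] and
the second for [a < k < h], gives as [N] tends to infinity
  [1 <= r (a + 1) / h + 2 (r - 1) \sum_(a < k < h) 1 / k],
and as [h] tends to infinity with [a / h = t],
  [1 <= r t + 2 (r - 1) ln (1 / t)].
The right-hand side is least at [t = 2 (r - 1) / r]; for [r = 1.2691534] this is
close to [123 / 290], where the value is still [8e-9] below [1]. *)

Require Import Defs.
From mathcomp Require Import all_boot all_order all_algebra.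
From mathcomp Require Import all_classical all_reals all_analysis.
From mathcomp Require Import measurable_realfun.
From mathcomp Require Import ring lra zify.

Import Order.TTheory GRing.Theory Num.Theory.

Local Open Scope ring_scope.

(** * Loads at grid points and an upper bound on the optimum *)

Section Comb.
Context {R : realType}.
Implicit Types (I X : seq R) (z : R).

Lemma loadE I X z : load I X z =
  (\sum_(0 <= k < size I) (nth 0%R X k <= z < nth 0%R X k + nth 0%R I k)%R)%N.
Proof. by rewrite big_mkord. Qed.

Lemma load_cat I J X Y z : size X = size I ->
  load (I ++ J) (X ++ Y) z = (load I X z + load J Y z)%N.
Proof.
move=> XI; rewrite !loadE size_cat.
rewrite (big_cat_nat (leq0n _) (leq_addr _ _)) /=; congr (_ + _)%N.
  by apply: eq_big_nat => k /andP[_ kI]; rewrite !nth_cat XI kI.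
rewrite -[X in index_iota X]add0n big_addn addKn; apply: eq_bigr => k _.
by rewrite !nth_cat XI ltnNge leq_addl /= addnK.
Qed.

(** An interval of length [s] inside [[0, 1)] starts at or before [1 - s] and ends at or after [s],
    so each of the last [n] items contains [z]. *)
Lemma load_run_cat_nseq (A : online_alg R) I n s z :
  is_input (I ++ nseq n s) -> 1 - s <= z < s ->
  load (I ++ nseq n s) (run A (I ++ nseq n s)) z = (load I (run A I) z + n)%N.
Proof.
move=> inp /andP[z1 z2]; have [sX X01] := run_is_assignment A inp.
set J := _ ++ _ in inp sX X01 *.
(* [place] sees only the earlier sizes, so the items of [I] keep their positions when more items
   follow. *)
have -> : run A J = run A I ++ drop (size I) (run A J).
  rewrite -{1}[run A J](cat_take_drop (size I)); congr (_ ++ _).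
  apply: (@eq_from_nth _ 0).
    rewrite size_take sX size_mkseq size_cat size_nseq; case: ltnP => //; lia.
  move=> k; rewrite size_take sX size_cat size_nseq => kI.
  have {}kI : (k < size I)%N by move: kI; case: ifP => //; lia.
  rewrite nth_take // !nth_mkseq ?size_cat ?ltn_addr //.
  by rewrite take_cat nth_cat kI.
rewrite load_cat ?size_mkseq //; congr (_ + _)%N.
rewrite /load size_nseq -[RHS](card_ord n) -sum1_card; apply: eq_bigr => k _.
rewrite nth_drop nth_nseq ltn_ord.
have := X01 (size I + k)%N; rewrite size_cat size_nseq ltn_add2l ltn_ord.
rewrite nth_cat ltnNge leq_addr /= addKn nth_nseq ltn_ord => /(_ isT).
move=> /andP[? ?].
by apply/eqP; rewrite eqb1; apply/andP; split; lra.
Qed.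

(** Every item contains a grid point, namely the least one at or to the right of its left endpoint:
    by minimality this point is less than [1 / m] away. *)
Lemma sum_load_grid N m X : (0 < m)%N -> is_assignment (nseq N m%:R^-1) X ->
  (N <= \sum_(j < m) load (nseq N m%:R^-1) X (j%:R / m%:R))%N.
Proof.
move=> m0 [_]; rewrite size_nseq => X01.
rewrite /load exchange_big /= size_nseq.
rewrite -[leqLHS](card_ord N) -sum1_card; apply: leq_sum => k _.
have mR : (0 : R) < m%:R by rewrite ltr0n.
rewrite nth_nseq ltn_ord; set x := nth 0 X k.
have /andP[x0 x1] : 0 <= x <= 1 - m%:R^-1.
  by have := X01 k (ltn_ord k); rewrite nth_nseq ltn_ord.
have exj : exists j, x <= j%:R / m%:R.
  exists m.-1; apply: le_trans x1 _.
  by rewrite -subn1 natrB // mulrBl divff ?gt_eqF // mul1r.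
case: (ex_minnP exj) => j xj minj.
have jm : (j < m)%N.
  rewrite -(ltn_predK m0) ltnS; apply: minj; apply: le_trans x1 _.
  by rewrite -subn1 natrB // mulrBl divff ?gt_eqF // mul1r.
rewrite (bigD1 (Ordinal jm)) //= xj /=.
suff -> : j%:R / m%:R < x + m%:R^-1 by [].
case: j xj minj {jm exj} => [|j] xj minj.
  by rewrite mul0r ltr_wpDl ?invr_gt0.
rewrite -natr1 mulrDl mul1r ltrD2r ltNge; apply/negP => /minj.
by rewrite ltnn.
Qed.

Lemma count_divn_eq N q j : (0 < q)%N ->
  (\sum_(i < N) (i %/ q == j)%N <= q)%N.
Proof.
move=> q0; rewrite -(big_mkord xpredT (fun i => nat_of_bool (i %/ q == j)%N)).
rewrite -big_mkcond /= sum1_count -size_filter -[leqRHS](size_iota (j * q)).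
apply: uniq_leq_size => [|i]; first by rewrite filter_uniq ?iota_uniq.
rewrite mem_filter mem_iota => /andP[/eqP <- _].
by rewrite leq_divM /= addnC -mulSn ltn_ceil.
Qed.

(** With [q = N / k], the small items form [k] columns of height [q] that tile [[0, k / m)], and all
    large items start at [k / m]. The load is thus at most [q] on the left of [k / m] and at most
    [n <= q] on the right. *)
Lemma opt_sand_nseq N m k n : (0 < k <= m)%N -> (k %| N)%N ->
  (n <= N %/ k)%N ->
  (opt (nseq N m%:R^-1 ++ nseq n (1 - k%:R / m%:R : R))%R <= N %/ k)%N.
Proof.
move=> /andP[k0 km] kN nq; set q := (N %/ k)%N in nq *; set I := _ ++ _.
have m0 : (0 : R) < m%:R by rewrite ltr0n; exact: leq_trans km.
have qN : (q * k = N)%N by rewrite divnK.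
pose Xs : seq R := mkseq (fun i => (i %/ q)%:R / m%:R) N.
pose Xb : seq R := nseq n (k%:R / m%:R).
have ltk i : (i < N)%N -> (i %/ q < k)%N.
  by rewrite -qN mulnC; case: (q) => [|q']; [rewrite muln0|rewrite ltn_divLR].
apply: leq_trans (@opt_le_peak _ _ (Xs ++ Xb) _) _.
  split=> [|i]; first by rewrite !size_cat size_mkseq !size_nseq.
  rewrite size_cat !size_nseq !nth_cat size_mkseq size_nseq => iNn.
  case: ltnP => iN.
    rewrite nth_mkseq // nth_nseq iN divr_ge0 //= lerBrDr.
    rewrite -[X in _ + X]mul1r -mulrDl natr1 ler_pdivrMr // mul1r ler_nat.
    exact: leq_trans (ltk _ iN) km.
  rewrite !nth_nseq; case: ifP; last by lia.
  by move=> _; rewrite divr_ge0 //= opprB addrC subrK.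
have [z /andP[z0 z1] <-] := peak_attained I (Xs ++ Xb).
rewrite load_cat; last by rewrite size_mkseq size_nseq.
have sandE i : (i < N)%N -> (nth 0 Xs i <= z < nth 0 Xs i +
    nth 0 (nseq N m%:R^-1) i) = ((i %/ q)%:R <= z * m%:R < (i %/ q).+1%:R).
  move=> iN; rewrite nth_mkseq // nth_nseq iN ler_pdivrMr //.
  by rewrite -[X in _ + X]mul1r -mulrDl natr1 ltr_pdivlMr.
have [zk|kz] := ltP z (k%:R / m%:R).
  have -> : load (nseq n (1 - k%:R / m%:R)) Xb z = 0%N.
    rewrite /load size_nseq big1 // => i _.
    by rewrite nth_nseq ltn_ord leNgt zk.
  rewrite addn0 /load size_nseq; case: (posnP q) => [q0|q0].
    by rewrite big1 // => i _; have := ltn_ord i; lia.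
  (* A small item contains [z] only if its column number is the integer part of [z * m]. *)
  apply: leq_trans (count_divn_eq N q (Num.truncn (z * m%:R)) q0).
  apply: leq_sum => i _; rewrite sandE //.
  by case: (boolP (_ <= _ < _)) => // /truncn_def ->; rewrite eqxx.
have -> : load (nseq N m%:R^-1) Xs z = 0%N.
  rewrite /load size_nseq big1 // => i _.
  rewrite sandE // andbC ltNge; suff -> : (i %/ q).+1%:R <= z * m%:R by [].
  by apply: le_trans (_ : k%:R <= _); rewrite ?ler_nat ?ltk // -ler_pdivrMr.
rewrite add0n (leq_trans _ nq) // (leq_trans (load_le_size _ _ _)) //.
by rewrite size_nseq.
Qed.

End Comb.

(** * Expected loads and expected cost *)

Section Expect.
Context {R : realType} d (T : measurableType d) (P : probability T R).

Lemma measurable_load (A : randomized_alg R T) I z : is_input I ->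
  measurable_fun setT
    (fun w => (load I (run (alg_of_seed A w) I) z)%:R : R).
Proof.
move=> inp; rewrite /load.
under eq_fun do rewrite natr_sum.
apply: measurable_sum => k.
have mX : measurable_fun setT
    (fun w => nth 0 (run (alg_of_seed A w) I) k : R).
  under eq_fun do rewrite nth_mkseq ?ltn_ord //.
  apply: measurable_place; last by apply: (all_nthP 0 inp).
  by apply/allP => s /mem_take; apply: (allP inp).
have -> : (fun w => (nth 0 (run (alg_of_seed A w) I) k <= z <
    nth 0 (run (alg_of_seed A w) I) k + nth 0 I k)%R%:R : R) =
  (fun w => if (nth 0 (run (alg_of_seed A w) I) k <= z) &&
    (z < nth 0 (run (alg_of_seed A w) I) k + nth 0 I k) then 1 else 0).
  by apply/funext => w; case: ifP.
apply: measurable_fun_ifT; [|exact: measurable_cst|exact: measurable_cst].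
apply: measurable_and.
  by apply: measurable_fun_ler; [exact: mX|exact: measurable_cst].
apply: measurable_fun_ltr; first exact: measurable_cst.
by apply: measurable_funD; [exact: mX|exact: measurable_cst].
Qed.

(* Measurability of the cost is avoided: the integral of a nonnegative function
   is defined as a supremum over simple functions, hence is monotone anyway. *)
Lemma le_integral_load (A : randomized_alg R T) I z : 0 <= z < 1 ->
  (\int[P]_w (load I (run (alg_of_seed A w) I) z)%:R%:E <=
     expected_cost P A I)%E.
Proof.
move=> z01; rewrite /expected_cost expectation.unlock.
rewrite ge0_integralTE => [|w]; last by rewrite lee_fin.
rewrite ge0_integralTE => [|w]; last by rewrite lee_fin.
apply: le_ereal_sup => _ [f fl <-]; exists f => // w.
apply: le_trans (fl w) _; by rewrite lee_fin ler_nat load_le_peak.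
Qed.

End Expect.

(** * Estimates for a logarithm and for harmonic sums *)

Lemma expR_ge_sum (R : realType) (c : R) n : 0 <= c ->
  \sum_(0 <= i < n) c ^+ i / i`!%:R <= expR c.
Proof.
move=> c0.
have nd : {homo series (exp_coeff c) : n p / (n <= p)%N >-> n <= p}.
  apply/nondecreasing_seqP => p; rewrite /series /= big_nat_recr //= lerDl.
  exact: exp_coeff_ge0.
exact: (nondecreasing_cvgn_le nd (is_cvg_series_exp_coeff c)).
Qed.

(* The final estimate tolerates an error of [1.5e-8] here. *)
Lemma ln_290_123 (R : realType) : ln (290%:R / 123%:R : R) <=
  857%:R / 10%:R ^+ 3 + 696%:R / 10%:R ^+ 6 + 57%:R / 10%:R ^+ 8.
Proof.
set c : R := _ + _; have c0 : 0 <= c by rewrite /c; lra.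
rewrite -ler_expR lnK ?posrE; last by lra.
(* Twelve terms of the exponential series at [c] already reach 290/123; [rec] obtains each term from
   the preceding one, which leaves a comparison of rationals. *)
apply: le_trans (expR_ge_sum _ _ 12 c0).
do 11 (rewrite big_nat_recl; last by []).
rewrite big_nat1.
have rec i : c ^+ i.+1 / i.+1`!%:R = c ^+ i / i`!%:R * (c / i.+1%:R).
  by rewrite factS natrM exprSr invfM; ring.
by rewrite !rec expr0 fact0 divr1 /c; lra.
Qed.

(** Taking [x = 1 / (h + 1)] in [ln (1 - x) <= - x] gives [1 / (h + 1) <= ln ((h + 1) / h)], and
    these logarithms telescope. *)
Lemma sum_invn_le_ln (R : realType) (a h : nat) : (0 < a)%N -> (a <= h)%N ->
  \sum_(a.+1 <= k < h.+1) (k%:R^-1 : R) <= ln (h%:R / a%:R).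
Proof.
move=> a0; elim: h => [|h IH]; first by case: a a0.
rewrite leq_eqVlt => /predU1P[<-|ah].
  by rewrite big_geq // divff ?ln1 // pnatr_eq0 -lt0n.
have h0 : (0 < h)%N by exact: leq_trans a0 ah.
have h0R : (0 : R) < h%:R by rewrite ltr0n.
have hS0R : (0 : R) < h.+1%:R by rewrite ltr0n.
have a0R : (0 : R) < a%:R by rewrite ltr0n.
rewrite big_nat_recr //=.
have -> : h.+1%:R / a%:R = (h%:R / a%:R) * (h.+1%:R / h%:R) :> R.
  by field; rewrite !gt_eqF.
rewrite lnM ?posrE ?divr_gt0 //; apply: lerD; first exact: IH.
rewrite -[X in ln X]invf_div lnV ?posrE ?divr_gt0 // lerNr.
have -> : h%:R / h.+1%:R = 1 + - h.+1%:R^-1 :> R.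
  by rewrite -natr1; field; rewrite natr1 gt_eqF.
apply: le_ln1Dx; rewrite ltrN2 invf_lt1 // ltr1n; lia.
Qed.

(** * The branches of the adversary and the lower bound *)

Section Bound.
Context {R : realType} d (T : measurableType d) (P : probability T R).

(* Stopping after the small items is the case [n = 0]. *)
Definition branch (N m n k : nat) : seq R :=
  nseq N m%:R^-1 ++ nseq n (1 - k%:R / m%:R).

Lemma is_input_branch N m n k : (0 < m)%N -> (k < m)%N ->
  is_input (branch N m n k).
Proof.
move=> m0 km; have mR : (0 : R) < m%:R by rewrite ltr0n.
rewrite /is_input /branch all_cat !all_nseq /is_size.
apply/andP; split; apply/orP; right.
  by rewrite invr_gt0 mR invf_le1 // ler1n.
by rewrite subr_gt0 ltr_pdivrMr // mul1r ltr_nat km gerBl divr_ge0.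
Qed.

Definition branch_load (A : online_alg R) (N m n k j : nat) : nat :=
  load (branch N m n k) (run A (branch N m n k)) (j%:R / m%:R).

(** For [k < h] the indices [k] and [m - 1 - k] run through all grid indices once, so the small
    items contribute at least [N] in total. Each large item of branch [k] contains both points of
    that branch, which adds [2 * n k]. *)
Lemma sum_loads_branch (A : online_alg R) N h (n : nat -> nat) :
  n 0%N = 0%N -> (0 < h)%N ->
  (N + 2 * \sum_(0 <= k < h) n k <=
    \sum_(0 <= k < h) (branch_load A N h.*2 (n k) k k +
      branch_load A N h.*2 (n k) k (h.*2.-1 - k)))%N.
Proof.
move=> n0 h0; set m := h.*2; have m0 : (0 < m)%N by rewrite double_gt0.
have mR : (0 : R) < m%:R by rewrite ltr0n.
set S : seq R := nseq N m%:R^-1.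
pose F j := load S (run A S) (j%:R / m%:R).
have inS : is_input S.
  by have := is_input_branch N m 0 0 m0 m0; rewrite /branch cats0.
have LF k j : (k < h)%N -> (k <= j <= m.-1 - k)%N ->
    branch_load A N m (n k) k j = (F j + n k)%N.
  move=> kh /andP[kj jm]; have km : (k < m)%N by rewrite /m; lia.
  rewrite /branch_load /branch; case: (posnP k) => [->|k0].
    by rewrite n0 cats0 addn0.
  apply: load_run_cat_nseq; first exact: is_input_branch.
  rewrite opprB addrC subrK ler_pM2r ?invr_gt0 // ler_nat kj /=.
  rewrite ltrBrDr -mulrDl ltr_pdivrMr // mul1r -natrD ltr_nat.
  by rewrite /m in jm *; lia.
have hm : (h <= m)%N by rewrite /m; lia.
have rev : (\sum_(h <= j < m) F j = \sum_(0 <= k < h) F (m.-1 - k))%N.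
  rewrite big_nat_rev /= -[X in index_iota X]add0n big_addn.
  have -> : (m - h = h)%N by rewrite /m; lia.
  by apply: eq_big_nat => k kh; congr F; rewrite /m; lia.
have := sum_load_grid N m _ m0 (run_is_assignment A inS).
rewrite -/S -(big_mkord xpredT F) (big_cat_nat (leq0n _) hm) /= rev.
rewrite -big_split /= -(leq_add2r (2 * \sum_(0 <= k < h) n k)) => NF.
apply: leq_trans NF _; rewrite big_distrr -big_split /=.
rewrite big_nat_cond [leqRHS]big_nat_cond.
apply: leq_sum => k /andP[/andP[_ kh] _].
by rewrite !LF // /m; lia.
Qed.

(** The inequality for loads holds for every fixed seed, so it can be integrated. Each branch counts
    twice because the peak bounds the load at either of its two points. *)
Lemma sum_expected_cost_branch (A : randomized_alg R T) N h (n : nat -> nat) :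
  n 0%N = 0%N -> (0 < h)%N ->
  ((N + 2 * \sum_(0 <= k < h) n k)%:R%:E <=
    \sum_(k < h) (expected_cost P A (branch N h.*2 (n k) k) +
      expected_cost P A (branch N h.*2 (n k) k)))%E.
Proof.
move=> n0 h0; set m := h.*2; have m0 : (0 < m)%N by rewrite double_gt0.
have mR : (0 : R) < m%:R by rewrite ltr0n.
pose L k j w := (branch_load (alg_of_seed A w) N m (n k) k j)%:R%:E : \bar R.
have L0 k j w : (0 <= L k j w)%E by rewrite lee_fin.
have mL (k : 'I_h) j : measurable_fun setT (L k j).
  apply/measurable_EFinP; apply: measurable_load.
  by apply: is_input_branch => //; have := ltn_ord k; rewrite /m; lia.
apply: (@le_trans _ _
  (\sum_(k < h) \int[P]_w (L k k w + L k (m.-1 - k)%N w))%E).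
  rewrite -ge0_integral_sum //; last 2 first.
    by move=> k; apply: emeasurable_funD; exact: mL.
    by move=> k w _; rewrite adde_ge0.
  apply: (@le_trans _ _
    (\int[P]_w (cst (N + 2 * \sum_(0 <= k < h) n k)%:R%:E w))%E).
    by rewrite integral_cst //= probability_setT mule1.
  apply: ge0_le_integral => //.
  - by move=> w _; rewrite lee_fin.
  - by apply: emeasurable_sum => k; apply: emeasurable_funD; exact: mL.
  - move=> w _ /=; have := sum_loads_branch (alg_of_seed A w) N h n n0 h0.
    rewrite -(ler_nat R) -lee_fin => /le_trans; apply.
    rewrite (big_mkord xpredT) natr_sum -sumEFin.
    by apply: lee_sum => k _; rewrite natrD EFinD.
apply: lee_sum => k _.
rewrite ge0_integralD //.
have z01 j : (j < m)%N -> 0 <= (j%:R / m%:R : R) < 1.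
  by move=> jm; rewrite divr_ge0 //= ltr_pdivrMr // mul1r ltr_nat.
by apply: leeD; apply: le_integral_load; apply: z01; have := ltn_ord k;
  rewrite /m; lia.
Qed.

Lemma ratio_ge_sum (A : randomized_alg R T) r a h : 0 <= r -> (a < h)%N ->
  ratio_at_most (expected_cost P A) r ->
  1 <= r * a.+1%:R / h%:R + 2 * (r - 1) * \sum_(a.+1 <= k < h) k%:R^-1.
Proof.
move=> r0 ah [C ratioC]; apply/ler_addgt0Pr => e e0.
have h0 : (0 < h)%N by exact: leq_ltn_trans ah.
have hR : (0 : R) < h%:R by rewrite ltr0n.
set m := h.*2; have m0 : (0 < m)%N by rewrite double_gt0.
(* The factor [m!] makes [N] divisible by every [k] with [0 < k <= m]; the factor [t] makes [N] so
   large that the additive constants are absorbed by [e * N]. *)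
set t := (Num.truncn (2 * h%:R * `|C| / e)).+1; set N := (m`! * t)%N.
have N0 : (0 < N)%N by rewrite muln_gt0 fact_gt0.
have NR : (0 : R) < N%:R by rewrite ltr0n.
have dvdN k : (0 < k <= m)%N -> (k %| N)%N.
  by move=> km; rewrite dvdn_mulr ?dvdn_fact.
have divN k : (0 < k <= m)%N -> (N %/ k)%:R = N%:R / k%:R :> R.
  move=> km; have /andP[k0 _] := km; rewrite -[in RHS](divnK (dvdN _ km)) natrM.
  by rewrite mulfK // pnatr_eq0 -lt0n.
have Ce : 2 * h%:R * C <= e * N%:R.
  apply: le_trans (_ : 2 * h%:R * `|C| <= _).
    by rewrite ler_wpM2l ?ler_norm // mulr_ge0.
  rewrite [e * _]mulrC -ler_pdivrMr //; apply: le_trans (_ : t%:R <= _).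
    by rewrite ltW // truncnS_gt.
  by rewrite ler_nat leq_pmull ?fact_gt0.
(* The adversary stops in the branches [k <= a] and continues in the others; [o k] bounds the
   optimum of branch [k]. *)
pose n k := if (k <= a)%N then 0%N else (N %/ k)%N.
pose o k := if (k <= a)%N then (N %/ m)%N else (N %/ k)%N.
have optE k : (k < h)%N -> (opt (branch N m (n k) k : seq R) <= o k)%N.
  move=> kh; rewrite /n /o; case: (leqP k a) => ka /=.
    (* Without large items the index of the branch is immaterial; index [m] spreads the small items
       over [m] columns. *)
    have -> : branch N m 0 k = branch N m 0 m by rewrite /branch !cats0.
    by apply: opt_sand_nseq; rewrite ?dvdN ?m0 /=.
  have km : (0 < k <= m)%N by rewrite /m; lia.
  by apply: opt_sand_nseq; rewrite ?dvdN.
have costE k : (k < h)%N ->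
    (expected_cost P A (branch N m (n k) k) <= (r * (o k)%:R + C)%:E)%E.
  move=> kh; apply: le_trans (ratioC _ _) _.
    by apply: is_input_branch => //; rewrite /m; lia.
  by rewrite lee_fin lerD2r ler_wpM2l // ler_nat optE.
have : ((N + 2 * \sum_(0 <= k < h) n k)%:R%:E <=
    \sum_(k < h) (r * (o k)%:R + C + (r * (o k)%:R + C))%:E)%E.
  apply: le_trans (sum_expected_cost_branch A N h n erefl h0) _.
  by apply: lee_sum => k _; rewrite EFinD leeD ?costE.
rewrite sumEFin lee_fin 
  -(big_mkord xpredT (fun k => r * (o k)%:R + C + (r * (o k)%:R + C))).
have sum_split (F : nat -> R) : \sum_(0 <= k < h) F k =
  \sum_(0 <= k < a.+1) F k + \sum_(a.+1 <= k < h) F k.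
  by rewrite -big_cat_nat.
rewrite natrD natrM natr_sum !sum_split.
set H := \sum_(a.+1 <= k < h) k%:R^-1.
have -> : \sum_(0 <= k < a.+1) (n k)%:R = 0 :> R.
  by apply: big1_seq => k /=; rewrite mem_index_iota /n ltnS => /andP[_ ->].
have -> : \sum_(a.+1 <= k < h) (n k)%:R = N%:R * H.
  rewrite mulr_sumr; apply: eq_big_nat => k /andP[ak kh].
  by rewrite /n leqNgt ak /= divN // /m; lia.
have -> : \sum_(0 <= k < a.+1) (r * (o k)%:R + C + (r * (o k)%:R + C)) =
    a.+1%:R * (2 * (r * (N%:R / m%:R) + C)).
  rewrite mulr_natl -[in RHS](subn0 a.+1) -sumr_const_nat.
  apply: eq_big_nat => k /andP[_]; rewrite ltnS /o => ->.
  by rewrite divN ?m0 ?leqnn //; ring.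
have -> : \sum_(a.+1 <= k < h) (r * (o k)%:R + C + (r * (o k)%:R + C)) =
    2 * r * N%:R * H + 2 * C * (h%:R - a.+1%:R).
  rewrite -natrB // -sumr_const_nat /H !mulr_sumr -big_split /=.
  apply: eq_big_nat => k /andP[ak kh].
  by rewrite /o leqNgt ak /= divN; [ring|rewrite /m; lia].
have mE : m%:R = 2 * h%:R :> R by rewrite /m -muln2 natrM mulrC.
have -> : a.+1%:R * (2 * (r * (N%:R / m%:R) + C)) =
    N%:R * (r * a.+1%:R / h%:R) + 2 * C * a.+1%:R.
  by rewrite mE; field; rewrite gt_eqF.
(* The additive constants sum to [2 * h * C], which [Ce] bounds by [e * N]. *)
move=> bound; rewrite -(ler_pM2l NR) mulr1 mulrDr.
lra.
Qed.

Lemma ratio_ge (A : randomized_alg R T) r : 1 <= r ->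
  ratio_at_most (expected_cost P A) r ->
  1 <= r * (123%:R / 290%:R) + 2 * (r - 1) * ln (290%:R / 123%:R).
Proof.
move=> r1 ratior; apply/ler_addgt0Pr => e e0.
have r0 : 0 <= r by lra.
(* With [a = 123 q] and [h = 290 q], the successor in [a.+1] costs only [r / (290 q)], which is at
   most [e]. *)
set q := (Num.truncn (r / e)).+1.
have q0 : (0 : R) < q%:R by rewrite ltr0n.
have qe : r / q%:R <= e.
  by rewrite ler_pdivrMr // mulrC -ler_pdivrMr // ltW // truncnS_gt.
have aq : (123 * q < 290 * q)%N by rewrite ltn_pmul2r.
have := ratio_ge_sum A r _ _ r0 aq ratior.
have : \sum_((123 * q).+1 <= k < 290 * q) k%:R^-1 <= ln (290%:R / 123%:R : R).
  apply: le_trans (_ : \sum_((123 * q).+1 <= k < (290 * q).+1) k%:R^-1 <= _).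
    by rewrite [leRHS]big_nat_recr //= lerDl.
  apply: le_trans (sum_invn_le_ln _ _ _ _ (ltnW aq)) _.
    by rewrite muln_gt0.
  by rewrite !natrM -mulf_div divff ?mulr1 // gt_eqF.
move=> /(ler_wpM2l (_ : 0 <= 2 * (r - 1))) H; have {}H := H ltac:(lra).
move=> /le_trans; apply.
rewrite addrAC lerD //.
have -> : r * (123 * q).+1%:R / (290 * q)%:R =
    r * (123%:R / 290%:R) + r / q%:R / 290%:R.
  by rewrite -natr1 !natrM; field; rewrite gt_eqF.
rewrite lerD2l; apply: le_trans qe.
by rewrite ler_pdivrMr // ler_peMr ?divr_ge0 ?ler1n.
Qed.

Lemma randomized_lower_bound (A : randomized_alg R T) :
  ((12691534%:R / 10%:R ^+ 7)%:E <= asymptotic_ratio (expected_cost P A))%E.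
Proof.
apply: le_ereal_inf_tmp => _ [r [C ratioC] <-]; rewrite lee_fin leNgt.
apply/negP => r_lt.
set r0 : R := _ / _ in r_lt.
have r01 : 1 <= r0 by rewrite /r0; lra.
(* A ratio below [r0] makes [r0] achievable too, and [ratio_ge], which asks for a ratio of at least
   1, fails numerically at [r0]. *)
suff ratio0 : ratio_at_most (expected_cost P A) r0.
  have : 0 <= 2 * (r0 - 1) by lra.
  move=> /ler_wpM2l /(_ _ _ (ln_290_123 R)); have := ratio_ge A r0 r01 ratio0.
  rewrite /r0; lra.
exists C => I inI; apply: le_trans (ratioC I inI) _.
by rewrite lee_fin lerD2r ler_wpM2r // ltW.
Qed.

End Bound.

Lemma deterministic_lower_bound (R : realType) (A : online_alg R) :
  ((12691534%:R / 10%:R ^+ 7)%:E <=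
    asymptotic_ratio (fun I => (cost A I)%:R%:E))%E.
Proof.
(* A deterministic algorithm is a randomized one on a one-point seed space. *)
pose B : randomized_alg R unit := @RandomizedAlg R _ unit (fun=> A)
  (fun _ _ _ _ => measurable_cst _).
have -> : (fun I => (cost A I)%:R%:E) = expected_cost \d_tt B.
  by apply/funext => I; rewrite -(expectation_cst \d_tt).
exact: randomized_lower_bound.
Qed.

Theorem theorem4 (R : realType) :
  (forall A : online_alg R,
     ((12691534%:R / 10%:R ^+ 7)%:E <= asymptotic_ratio (fun I => (cost A I)%:R%:E))%E) /\
  (forall (d : measure_display) (T : measurableType d) (P : probability T R)
     (A : randomized_alg R T),
     ((12691534%:R / 10%:R ^+ 7)%:E <= asymptotic_ratio (expected_cost P A))%E).
Proof.
by split=> *; [exact: deterministic_lower_bound|exact: randomized_lower_bound].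
Qed.
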